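(* Let $S$ be a monoid and let $A,B,M$ be $S$-acts such that $M\leq A$ and $M\leq B$. If $a\in A$ and $b\in B$, then $\mathbf{gtp}(a/M;A)=\mathbf{gtp}(b/M;B)$ if and only if $\mathbf{pp}(a/M;A)=\mathbf{pp}(b/M;B)$, where Galois types are computed in the class $\mathbf{K}_{S\text{-}\mathbf{Act}_p}$ of $S$-acts with the pure subact relation.
   Context: Let $S$ be a monoid with identity $1$. A (left) $S$-act is a non-empty set $A$ with a map $S\times A\to A$ such that $1a=a$ and $s(ta)=(st)a$ for all $s,t\in S$, $a\in A$. A map $f:A\to B$ of $S$-acts is an $S$-homomorphism if $f(sa)=sf(a)$ for all $s,a$. $M\leq A$ ($M$ is a subact of $A$) means $M\subseteq A$ and the inclusion is an $S$-homomorphism. The language of $S$-acts has one unary function symbol for each $s\in S$; a pp-formula is a formula built from atomic formulas using only conjunctions and existential quantifiers (so it expresses solvability of a finite system of equations of the form $sx=ty$). An $S$-homomorphism $f:A\to B$ is a pure embedding if for every pp-formula $\varphi(\overline{x})$ and tuple $\overline{a}$ from $A$, $A\models\varphi(\overline{a})$ iff $B\models\varphi(f(\overline{a}))$ (in particular $f$ is injective). $A\leq_p B$ (pure subact) means $A\subseteq B$ and the inclusion is a pure embedding. $\mathbf{K}_{S\text{-}\mathbf{Act}_p}$ is the class of all $S$-acts ordered by $\leq_p$. Galois types: a pre-type is a triple $(b,X,N)$ with $N$ an $S$-act, $X\subseteq N$ a subset, $b\in N$. Set $(b_1,X_1,N_1)E_{at}(b_2,X_2,N_2)$ iff $X:=X_1=X_2$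 and there are an $S$-act $N$ and pure embeddings $f_i:N_i\to N$ with $f_i\upharpoonright X=\operatorname{id}_X$ ($i=1,2$) and $f_1(b_1)=f_2(b_2)$. Let $E$ be the transitive closure of $E_{at}$; $\mathbf{gtp}(b/X;N)$ is the $E$-class of $(b,X,N)$. The pp-type $\mathbf{pp}(b/M;N)$ of $b\in N$ over $M\subseteq N$ is the set of all formulas $\varphi(x,\overline{m})$, where $\varphi(x,\overline{y})$ is a pp-formula and $\overline{m}$ is a finite tuple of parameters from $M$, such that $N\models\varphi(b,\overline{m})$. *)

(* Defs.v *)
(* Acts over a monoid, pp-formulas in the language of acts, pure embeddings,
   and Galois types in the class of all acts ordered by purity (MathComp). *)
From Stdlib Require Export Relation_Operators.
From mathcomp Require Export all_boot.
From mathcomp Require Export boolp classical_sets.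

Set Implicit Arguments.
Unset Strict Implicit.
Unset Printing Implicit Defensive.

Local Open Scope group_scope.
Local Open Scope classical_set_scope.

Record sact (S : monoidType) := SAct {
  sact_carrier :> Type;
  act : S -> sact_carrier -> sact_carrier;
  sact_nonempty : inhabited sact_carrier;
  act1 : forall a, act 1 a = a;
  actM : forall s t a, act s (act t a) = act (s * t) a }.

Definition shom (S : monoidType) (A B : sact S) (f : A -> B) : Prop :=
  forall s a, f (act s a) = act s (f a).

(* [incl X Y] stands for "X is a subset of Y" and [subact M A] for "M <= A".
   Membership in a common set-theoretic universe is not available for carrier
   types, so an inclusion is carried by an explicit injective map; a
   condition "f restricted to X is the identity" becomes the commutation of f
   with the inclusion maps. *)
Record incl (X Y : Type) := Incl {
  incl_fun :> X -> Y;
  incl_inj : injective incl_fun }.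

Record subact (S : monoidType) (M A : sact S) := SubAct {
  subact_incl :> incl M A;
  subact_shom : shom subact_incl }.

(* Formulas whose free variables are among n variables, in de Bruijn style:
   under [PPEx] the variable 0 is the bound one, and the others are shifted. *)
Inductive term (S : monoidType) (n : nat) :=
| TVar of 'I_n
| TAct of S & term S n.

Inductive ppform (S : monoidType) : nat -> Type :=
| PPEq n of term S n & term S n : ppform S n
| PPAnd n of ppform S n & ppform S n : ppform S n
| PPEx n of ppform S n.+1 : ppform S n.

Fixpoint teval (S : monoidType) (A : sact S) n (e : n.-tuple A)
    (t : term S n) : A :=
  match t with
  | TVar i => tnth e i
  | TAct s u => act s (teval e u)
  end.

Fixpoint ppsat (S : monoidType) (A : sact S) n (phi : ppform S n) :
    n.-tuple A -> Prop :=
  match phi in ppform _ n return n.-tuple A -> Prop with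
  | PPEq _ t u => fun e => teval e t = teval e u
  | PPAnd _ phi1 phi2 => fun e => ppsat phi1 e /\ ppsat phi2 e
  | PPEx _ psi => fun e => exists a : A, ppsat psi [tuple of a :: e]
  end.

Definition pure_embedding (S : monoidType) (A B : sact S) (f : A -> B) : Prop :=
  shom f /\
  forall n (phi : ppform S n) (a : n.-tuple A),
    ppsat phi a <-> ppsat phi [tuple of map f a].

Record pretype (S : monoidType) (X : Type) := PreType {
  pt_act : sact S;
  pt_incl : incl X pt_act;
  pt_elt : pt_act }.

Definition Eat (S : monoidType) (X : Type) (p q : pretype S X) : Prop :=
  exists (N : sact S) (j : incl X N) (f : pt_act p -> N) (g : pt_act q -> N),
    [/\ pure_embedding f, pure_embedding g,
        (forall x, f (pt_incl p x) = j x),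
        (forall x, g (pt_incl q x) = j x)
      & f (pt_elt p) = g (pt_elt q)].

Definition gtp (S : monoidType) (X : Type) (N : sact S) (i : incl X N)
    (b : N) : set (pretype S X) :=
  [set q | clos_trans _ (@Eat S X) (PreType i b) q].

(* A formula phi(x, m) with parameters m from M: variable 0 of [ppp_form] is x,
   and variable k.+1 is instantiated by the k-th entry of [ppp_params]. *)
Record ppparam (S : monoidType) (M : Type) := PPParam {
  ppp_arity : nat;
  ppp_form : ppform S ppp_arity.+1;
  ppp_params : ppp_arity.-tuple M }.

Definition pp_type (S : monoidType) (X : Type) (N : sact S) (i : incl X N)
    (b : N) : set (ppparam S X) :=
  [set phi | ppsat (ppp_form phi) [tuple of b :: map i (ppp_params phi)]].

(* Main.v *)
(* Pure embeddings preserve and reflect pp-formulas, so equality of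
   Galois types gives equality of pp-types along a chain of atomic equivalences.
   Conversely, let C be the coproduct of M with the free act on one generator,
   mapped to A and to B by sending the generator to a and to b. Equality of the
   pp-types says exactly that a tuple of C satisfies the same pp-formulas in A
   and in B. Let N be the pushout of A and B over C. Equations between acts only
   involve unary functions, so a finite system solved in N with parameters in A
   splits into equations in A, equations in B, and equations s x = t y with x in
   A and y in B; the common value of the latter comes from C. The part in B is
   thus a pp-formula with parameters from C, which can also be solved in A. *)
Require Import Defs.

Set Implicit Arguments.
Unset Strict Implicit.
Unset Printing Implicit Defensive.

Local Open Scope group_scope.
Local Open Scope classical_set_scope.

(** * Substitution in pp-formulas and blocks of quantifiers *)

Section Substitution.
Variable S : monoidType.

Fixpoint tsubst n m (sigma : 'I_n -> term S m) (t : term S n) : term S m :=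
  match t with
  | TVar i => sigma i
  | TAct s u => TAct s (tsubst sigma u)
  end.

Definition subst_up n m (sigma : 'I_n -> term S m) (i : 'I_n.+1) :
    term S m.+1 :=
  if unlift ord0 i is Some j
  then tsubst (fun k => TVar S (lift ord0 k)) (sigma j)
  else TVar S ord0.

Fixpoint ppsubst n (phi : ppform S n) :
    forall m, ('I_n -> term S m) -> ppform S m :=
  match phi in ppform _ n return forall m, ('I_n -> term S m) -> ppform S m with
  | PPEq _ t u => fun m sigma => PPEq (tsubst sigma t) (tsubst sigma u)
  | PPAnd _ phi1 phi2 =>
      fun m sigma => PPAnd (ppsubst phi1 sigma) (ppsubst phi2 sigma)
  | PPEx _ psi => fun m sigma => PPEx (ppsubst psi (subst_up sigma))
  end.

Lemma teval_subst (A : sact S) n m (sigma : 'I_n -> term S m)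
    (e : m.-tuple A) (d : n.-tuple A) (t : term S n) :
  (forall i, teval e (sigma i) = tnth d i) ->
  teval e (tsubst sigma t) = teval d t.
Proof. by move=> ed; elim: t => [i|s u IHu] /=; rewrite ?ed ?IHu. Qed.

Lemma ppsat_subst (A : sact S) n (phi : ppform S n) m
    (sigma : 'I_n -> term S m) (e : m.-tuple A) (d : n.-tuple A) :
  (forall i, teval e (sigma i) = tnth d i) ->
  ppsat (ppsubst phi sigma) e <-> ppsat phi d.
Proof.
elim: phi m sigma e d => {n} [n t u|n phi1 IH1 phi2 IH2|n psi IH] m sigma e d ed /=.
- by rewrite !(teval_subst _ ed).
- by rewrite (IH1 _ _ _ _ ed) (IH2 _ _ _ _ ed).
- have up_ed x i :
      teval [tuple of x :: e] (subst_up sigma i) = tnth [tuple of x :: d] i.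
    rewrite /subst_up; case: unliftP => [j ->|->] /=.
      by rewrite tnthS -ed; apply: teval_subst => k /=; rewrite tnthS.
    by rewrite !tnth0.
  by split=> -[x xP]; exists x; apply/(IH _ _ _ _ (up_ed x)).
Qed.

(** The variables to be bound come first, so that [n'.+1 + m] unfolds to a successor and [PPEx]
    applies without a cast. *)
Fixpoint ppexs n m : ppform S (n + m) -> ppform S m :=
  match n return ppform S (n + m) -> ppform S m with
  | 0 => id
  | n'.+1 => fun phi => ppexs (PPEx (phi : ppform S (n' + m).+1))
  end.

Lemma ppsat_exs (A : sact S) n m (phi : ppform S (n + m)) (e : m.-tuple A) :
  ppsat (ppexs phi) e <-> exists w : n.-tuple A, ppsat phi [tuple of w ++ e].
Proof.
elim: n phi => [|n IHn] phi /=.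
  split=> [phie|[w]].
    exists [tuple]; suff -> : [tuple of [tuple] ++ e] = e by [].
    exact: val_inj.
  by suff -> : [tuple of w ++ e] = e; [|apply: val_inj; rewrite /= tuple0].
rewrite IHn /=; split=> [[w [x xP]]|[w]].
  exists [tuple of x :: w].
  suff -> : [tuple of [tuple of x :: w] ++ e] = [tuple of x :: [tuple of w ++ e]]
    by [].
  exact: val_inj.
case/tupleP: w => x w xP; exists w, x.
suff -> : [tuple of x :: [tuple of w ++ e]] = [tuple of [tuple of x :: w] ++ e]
  by [].
exact: val_inj.
Qed.

Fixpoint tcoef n (t : term S n) : S :=
  if t is TAct s u then s * tcoef u else 1.

Fixpoint tvar n (t : term S n) : 'I_n :=
  match t with TVar i => i | TAct _ u => tvar u end.

(** All function symbols are unary, so a term has the form s x and an equation mentions at most two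
    elements. *)
Lemma tevalE (A : sact S) n (e : n.-tuple A) (t : term S n) :
  teval e t = act (tcoef t) (tnth e (tvar t)).
Proof. by elim: t => [i|s u /= ->] /=; rewrite ?act1 ?actM. Qed.

End Substitution.

(** * Homomorphisms and purity *)

Section Purity.
Variable S : monoidType.

Lemma teval_shom (A B : sact S) (f : A -> B) n (e : n.-tuple A) (t : term S n) :
  shom f -> teval [tuple of map f e] t = f (teval e t).
Proof. by move=> fS; elim: t => [i|s u /= ->] /=; rewrite ?tnth_map ?fS. Qed.

Lemma ppsat_shom (A B : sact S) (f : A -> B) n (phi : ppform S n)
    (e : n.-tuple A) :
  shom f -> ppsat phi e -> ppsat phi [tuple of map f e].
Proof.
move=> fS; elim: phi e => {n} [n t u|n phi1 IH1 phi2 IH2|n psi IH] e /=.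
- by rewrite !teval_shom // => ->.
- by case=> /IH1 ? /IH2.
- case=> x /IH xP; exists (f x).
  suff -> : [tuple of f x :: [tuple of map f e]]
    = [tuple of map f [tuple of x :: e]] by [].
  exact: val_inj.
Qed.

Lemma pure_embedding_id (A : sact S) : pure_embedding (@id A).
Proof.
split=> // n phi e; suff -> : [tuple of map id e] = e by [].
by apply: val_inj; rewrite /= map_id.
Qed.

Lemma pure_embedding_inj (A B : sact S) (f : A -> B) :
  pure_embedding f -> injective f.
Proof.
move=> [_ fP] x y fxy.
have /= := fP 2 (PPEq (TVar S ord0) (TVar S (lift ord0 ord0))) [tuple x; y].
by rewrite !(tnthS, tnth0) => -[_]; apply.
Qed.

End Purity.

(** * Purity of one leg of an amalgam *)

Section Amalgam.
Variables (S : monoidType) (A B N : sact S) (C : Type).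
Variables (u : C -> A) (v : C -> B) (f : A -> N) (g : B -> N).

Hypothesis fS : shom f.
Hypothesis gS : shom g.
Hypothesis fI : injective f.
Hypothesis gI : injective g.
Hypothesis fgE : forall x y, f x = g y -> exists c, x = u c /\ y = v c.
Hypothesis fg_surj : forall z, (exists x, z = f x) \/ (exists y, z = g y).
Hypothesis vuP : forall n (phi : ppform S n) (c : n.-tuple C),
  ppsat phi [tuple of map v c] -> ppsat phi [tuple of map u c].

Let fg (z : A + B) : N := match z with inl x => f x | inr y => g y end.

(** The value [b0] is a placeholder: the formulas built below put no condition on coordinates that
    lie in A. *)
Let projB (b0 : B) (z : A + B) : B := if z is inr y then y else b0.

(* [psi] is the part of [phi] that lives in B: its solutions [y] in A need only
   be used at the coordinates that [z] places in B. *)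
Lemma amalgam_interpolation (b0 : B) n (phi : ppform S n)
    (z : n.-tuple (A + B)) :
  ppsat phi [tuple of map fg z] ->
  exists k (psi : ppform S (n + k)) (c : k.-tuple C),
    ppsat psi [tuple of map (projB b0) z ++ map v c] /\
    forall x y : n.-tuple A,
      (forall i, tnth x i = if tnth z i is inl xi then xi else tnth y i) ->
      ppsat psi [tuple of y ++ map u c] -> ppsat phi x.
Proof.
elim: phi z => {n} [n t t'|n phi1 IH1 phi2 IH2|n phi IH] z /=.
- rewrite !tevalE !tnth_map.
  set s := tcoef t; set s' := tcoef t'; set i := tvar t; set i' := tvar t'.
  case zi: (tnth z i) => [x0|y0]; case zi': (tnth z i') => [x0'|y0'] /=;
    rewrite -?fS -?gS.
  (* Both sides lie in A, where the equation already holds, so nothing is asked in B and [psi] is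
     trivial. *)
  + move=> /fI E; exists 0%N, (PPEq (TVar S (lshift 0 i)) (TVar S (lshift 0 i))).
    exists [tuple]; split=> // x y xy _.
    by rewrite !tevalE !xy -/i -/i' zi zi'.
  (* The sides meet in the image of some [c], which becomes a new parameter; [psi] says s' y = c. *)
  + move=> /fgE[c [uc vc]].
    exists 1%N, (PPEq (TAct s' (TVar S (lshift 1 i'))) (TVar S (rshift n ord0))).
    exists [tuple c]; split=> [|x y xy] /=.
      rewrite tnth_lshift tnth_rshift !tnth_map zi' /= vc.
      by rewrite (tnth_nth c).
    rewrite tnth_lshift tnth_rshift tnth_map (tnth_nth c) /= => E.
    by rewrite !tevalE !xy -/i -/i' zi zi' -/s -/s' E uc.
  + move=> /esym/fgE[c [uc vc]].
    exists 1%N, (PPEq (TAct s (TVar S (lshift 1 i))) (TVar S (rshift n ord0))).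
    exists [tuple c]; split=> [|x y xy] /=.
      rewrite tnth_lshift tnth_rshift !tnth_map zi /= vc.
      by rewrite (tnth_nth c).
    rewrite tnth_lshift tnth_rshift tnth_map (tnth_nth c) /= => E.
    by rewrite !tevalE !xy -/i -/i' zi zi' -/s -/s' E uc.
  + move=> /gI E.
    exists 0%N, (PPEq (TAct s (TVar S (lshift 0 i)))
                    (TAct s' (TVar S (lshift 0 i')))).
    exists [tuple]; split=> [|x y xy] /=.
      by rewrite !tnth_lshift !tnth_map zi zi'.
    by rewrite !tnth_lshift !tevalE !xy -/i -/i' zi zi'.
- case=> /IH1[k1 [psi1 [c1 [B1 A1]]]] /IH2[k2 [psi2 [c2 [B2 A2]]]].
  (* The parameter tuples are concatenated: [s1] and [s2] fix the first [n] variables and send the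
     others to their own block. *)
  pose s1 (i : 'I_(n + k1)) := TVar S (match split i with
    inl j => lshift (k1 + k2) j | inr j => rshift n (lshift k2 j) end).
  pose s2 (i : 'I_(n + k2)) := TVar S (match split i with
    inl j => lshift (k1 + k2) j | inr j => rshift n (rshift k1 j) end).
  have s1E (T : sact S) (w : C -> T) (y : n.-tuple T) i :
      teval [tuple of y ++ map w [tuple of c1 ++ c2]] (s1 i)
      = tnth [tuple of y ++ map w c1] i.
    rewrite /s1 /=; case: split_ordP => j ->.
      by rewrite !tnth_lshift.
    by rewrite !tnth_rshift !tnth_map tnth_lshift.
  have s2E (T : sact S) (w : C -> T) (y : n.-tuple T) i :
      teval [tuple of y ++ map w [tuple of c1 ++ c2]] (s2 i)
      = tnth [tuple of y ++ map w c2] i.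
    rewrite /s2 /=; case: split_ordP => j ->.
      by rewrite !tnth_lshift.
    by rewrite !tnth_rshift !tnth_map tnth_rshift.
  exists (k1 + k2), (PPAnd (ppsubst psi1 s1) (ppsubst psi2 s2)).
  exists [tuple of c1 ++ c2]; split=> [|x y xy] /=.
    by rewrite (ppsat_subst _ (s1E _ _ _)) (ppsat_subst _ (s2E _ _ _)).
  rewrite (ppsat_subst _ (s1E _ _ _)) (ppsat_subst _ (s2E _ _ _)).
  by case=> /(A1 _ _ xy) ? /(A2 _ _ xy).
- case=> w wP; have {wP} [z0 z0P] :
      exists z0, ppsat phi [tuple of map fg [tuple of z0 :: z]].
    have [z0 E] : exists z0, w = fg z0.
      by case: (fg_surj w) => -[x ->]; [exists (inl x)|exists (inr x)].
    exists z0; rewrite E in wP.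
    suff -> : [tuple of map fg [tuple of z0 :: z]]
      = [tuple of fg z0 :: [tuple of map fg z]] by [].
    exact: val_inj.
  have [k [psi [c [psiB psiA]]]] := IH _ z0P.
  exists k, (PPEx (psi : ppform S (n + k).+1)), c; split=> [|x y xy] /=.
    exists (projB b0 z0).
    suff -> : [tuple of projB b0 z0 :: [tuple of map (projB b0) z ++ map v c]]
      = [tuple of map (projB b0) [tuple of z0 :: z] ++ map v c] by [].
    exact: val_inj.
  (* A witness in A is kept; one in B is replaced by the solution [y0] found in A. *)
  case=> y0 y0P; exists (if z0 is inl x0 then x0 else y0).
  apply: (psiA _ [tuple of y0 :: y]).
    by move=> i; case: (unliftP ord0 i) => [j ->|->]; rewrite ?tnthS ?tnth0.
  suff -> : [tuple of [tuple of y0 :: y] ++ map u c]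
    = [tuple of y0 :: [tuple of y ++ map u c]] by [].
  exact: val_inj.
Qed.

(** Existentially closing the part in B gives a pp-formula on a tuple of C; [vuP] moves it to A, and
    its solution there replaces the coordinates that were in B. *)
Lemma amalgam_pure : pure_embedding f.
Proof.
split=> // n phi e; split; first exact: ppsat_shom.
move=> phie; have [b0] := sact_nonempty B.
have [|k [psi [c [psiB psiA]]]] :=
    @amalgam_interpolation b0 n phi [tuple of map inl e].
  suff -> : [tuple of map fg [tuple of map inl e]] = [tuple of map f e] by [].
  by apply: val_inj; rewrite /= -map_comp.
have /vuP/ppsat_exs[y yP] : ppsat (ppexs psi) [tuple of map v c].
  by apply/ppsat_exs; exists [tuple of map (projB b0) [tuple of map inl e]].
by apply: (psiA _ y) => // i; rewrite tnth_map.
Qed.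

End Amalgam.

(** * The pushout of two acts over a common part *)

Section Pushout.
Variables (S : monoidType) (A B : sact S) (C : Type) (u : C -> A) (v : C -> B).
(** C is only a type: this closes the set of pairs (u c, v c) under the action. *)
Hypothesis uvS :
  forall s c, exists d, u d = act s (u c) /\ v d = act s (v c).
Hypothesis uvP : forall n (phi : ppform S n) (c : n.-tuple C),
  ppsat phi [tuple of map u c] <-> ppsat phi [tuple of map v c].

Lemma eq_pushout c d : u c = u d <-> v c = v d.
Proof.
have /= := uvP (PPEq (TVar S ord0) (TVar S (lift ord0 ord0))) [tuple c; d].
by rewrite !tnth_map !(tnthS, tnth0).
Qed.

(* By [eq_pushout] the images of C in A and B are isomorphic, so the pushout is
   A together with the elements of B outside the image of C. *)
Let car : Type := (A + {y : B | ~ exists c, v c = y})%type.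

Let inB (y : B) : car :=
  match pselect (exists c, v c = y) with
  | left h => inl (u (projT1 (cid h)))
  | right h => inr (exist _ y h)
  end.

(** The preimage picked by [cid] may differ from [c], but [eq_pushout] gives both the same image in
    A. *)
Let inB_v c : inB (v c) = inl (u c).
Proof.
rewrite /inB; case: pselect => [h|[]]; last by exists c.
by congr inl; apply/eq_pushout; case: cid.
Qed.

Let inB_out y (h : ~ exists c, v c = y) : inB y = inr (exist _ y h).
Proof.
rewrite /inB; case: pselect => // h'.
by rewrite (Prop_irrelevance h' h).
Qed.

(** The action can move an element of B into the image of C, hence the second use of [inB]. *)
Let pact (s : S) (z : car) : car :=
  match z with
  | inl x => inl (act s x)
  | inr y => inB (act s (sval y))
  end.

Let pact_inB s y : pact s (inB y) = inB (act s y).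
Proof.
have [[c <-]|h] := pselect (exists c, v c = y).
  by have [d [ud vd]] := uvS s c; rewrite inB_v /= -ud -vd inB_v.
by rewrite (inB_out h).
Qed.

Let car_nonempty : inhabited car.
Proof. by have [x] := sact_nonempty A; exists; left. Qed.

Let pact1 z : pact 1 z = z.
Proof. by case: z => [x|[y h]] /=; rewrite act1 // (inB_out h). Qed.

Let pactM s t z : pact s (pact t z) = pact (s * t) z.
Proof. by case: z => [x|[y h]]; rewrite ?pact_inB /= actM. Qed.

Lemma pp_amalgamation :
  exists (N : sact S) (f : A -> N) (g : B -> N),
    [/\ pure_embedding f, pure_embedding g & forall c, f (u c) = g (v c)].
Proof.
pose N := SAct car_nonempty pact1 pactM.
pose f : A -> N := inl; pose g : B -> N := inB.
have fS : shom f by [].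
have gS : shom g by move=> s y; rewrite /g -pact_inB.
have fI : injective f by move=> x y [].
have fgE x y : f x = g y -> exists c, x = u c /\ y = v c.
  have [[c <-]|h] := pselect (exists c, v c = y).
    by rewrite /g inB_v => -[->]; exists c.
  by rewrite /g (inB_out h).
have gI : injective g.
  move=> y y'; have [[c <-]|h] := pselect (exists c, v c = y).
    by rewrite {1}/g inB_v => /fgE[d [/eq_pushout -> ->]].
  have [[c <-]|h'] := pselect (exists c, v c = y').
    rewrite {2}/g inB_v => /esym/fgE[d [_ yd]].
    by case: h; exists d.
  by rewrite /g (inB_out h) (inB_out h') => -[].
have fg_surj (z : N) : (exists x, z = f x) \/ (exists y, z = g y).
  by case: z => [x|[y h]]; [left; exists x|right; exists y; rewrite /g inB_out].
exists N, f, g; split; last by move=> c; rewrite /g inB_v.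
  by apply: (amalgam_pure fS gS fI gI fgE fg_surj) => n phi c /uvP.
(* Purity of [g] is the same lemma with A and B exchanged. *)
apply: (@amalgam_pure _ B A N C v u g f) => //.
- by move=> y x /esym/fgE[c [-> ->]]; exists c.
- by move=> z; case: (fg_surj z); [right|left].
- by move=> n phi c /uvP.
Qed.

End Pushout.

(** * Elements of the form s a or m, and their pp-formulas *)

Section PointedCoproduct.
Variables (S : monoidType) (M : sact S).

(* S + M is not bundled as an act, because the universe of S may be larger than
   the one in which acts live. *)
Definition pointed_copair (A : sact S) (i : M -> A) (a : A) (z : S + M) : A :=
  match z with inl s => act s a | inr m => i m end.

Lemma pointed_copair_act (A B : sact S) (i : M -> A) (j : M -> B)
    (a : A) (b : B) s z :
  shom i -> shom j ->
  exists d, pointed_copair i a d = act s (pointed_copair i a z) /\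
            pointed_copair j b d = act s (pointed_copair j b z).
Proof.
move=> iS jS; case: z => [t|m]; last by exists (inr (act s m)); rewrite /= iS jS.
by exists (inl (s * t)); rewrite /= !actM.
Qed.

(** Each entry of [c] is a term in the distinguished element or a parameter from M, so substitution
    turns [phi] into a pp-formula over M in that element. *)
Lemma pp_type_copair (A B : sact S) (iA : incl M A) (iB : incl M B)
    (a : A) (b : B) :
  pp_type iA a = pp_type iB b ->
  forall n (phi : ppform S n) (c : n.-tuple (S + M)),
    ppsat phi [tuple of map (pointed_copair iA a) c] <->
    ppsat phi [tuple of map (pointed_copair iB b) c].
Proof.
move=> ppE n phi c; have [m0] := sact_nonempty M.
(* [m0] fills the positions of entries from S, which [sigma] never refers to. *)
pose param (z : S + M) := if z is inr m then m else m0.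
pose sigma (i : 'I_n) :=
  if tnth c i is inl s then TAct s (TVar S ord0) else TVar S (lift ord0 i).
have sigmaE (D : sact S) (i : incl M D) (d : D) (j : 'I_n) :
    teval [tuple of d :: map i [tuple of map param c]] (sigma j)
    = tnth [tuple of map (pointed_copair i d) c] j.
  rewrite tnth_map /sigma; case cj: (tnth c j) => [s|m] /=.
    by rewrite tnth0.
  by rewrite tnthS !tnth_map cj.
rewrite -(ppsat_subst _ (sigmaE _ iA a)) -(ppsat_subst _ (sigmaE _ iB b)).
pose q := PPParam (ppsubst phi sigma) [tuple of map param c].
by have /(congr1 (fun P => P q)) := ppE; rewrite /pp_type /= => ->.
Qed.

End PointedCoproduct.

(** * Atomic equivalence and pp-types *)

Section GaloisTypes.
Variables (S : monoidType) (X : Type).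

Lemma Eat_refl (p : pretype S X) : Eat p p.
Proof.
by exists (pt_act p), (pt_incl p), id, id; split=> //; exact: pure_embedding_id.
Qed.

Lemma Eat_sym (p q : pretype S X) : Eat p q -> Eat q p.
Proof. by move=> [N [j [f [g [? ? ? ? ?]]]]]; exists N, j, g, f. Qed.

Lemma pp_type_pure (A N : sact S) (i : incl X A) (j : incl X N) (f : A -> N)
    (a : A) :
  pure_embedding f -> (forall x, f (i x) = j x) ->
  pp_type i a = pp_type j (f a).
Proof.
move=> [_ fP] fij; apply/funext => -[n phi m]; apply/propext.
rewrite /pp_type /= fP.
suff -> : [tuple of map f [tuple of a :: map i m]] = [tuple of f a :: map j m]
  by [].
apply: val_inj; rewrite /= -map_comp; congr cons.
exact: eq_map.
Qed.

Lemma Eat_pp_type (p q : pretype S X) :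
  Eat p q -> pp_type (pt_incl p) (pt_elt p) = pp_type (pt_incl q) (pt_elt q).
Proof.
move=> [N [j [f [g [fP gP fj gj fg]]]]].
by rewrite (pp_type_pure _ fP fj) (pp_type_pure _ gP gj) fg.
Qed.

Lemma Eat_gtp (A B : sact S) (i : incl X A) (j : incl X B) (a : A) (b : B) :
  Eat (PreType i a) (PreType j b) -> gtp i a = gtp j b.
Proof.
move=> E; apply/seteqP; split=> q; apply: t_trans; apply: t_step => //.
exact: Eat_sym.
Qed.

End GaloisTypes.

Theorem theorem2p16 (S : monoidType) (A B M : sact S)
    (iA : subact M A) (iB : subact M B) (a : A) (b : B) :
  gtp iA a = gtp iB b <-> pp_type iA a = pp_type iB b.
Proof.
split=> [gtpE|ppE].
  (* Reflexivity puts the pre-type of [b] in its own class, hence in that of [a], which yields a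
     chain to follow. *)
  have : gtp iB b (PreType iB b) by apply: t_step; exact: Eat_refl.
  rewrite -gtpE /gtp /= => chain.
  suff ppE (p q : pretype S M) : clos_trans _ (@Eat S M) p q ->
      pp_type (pt_incl p) (pt_elt p) = pp_type (pt_incl q) (pt_elt q).
    exact: ppE chain.
  by elim=> [{}p {}q /Eat_pp_type|p' r q' _ -> _ ->].
have [N [f [g [fP gP fg]]]] := pp_amalgamation
  (fun s z => pointed_copair_act a b s z
                (@subact_shom _ _ _ iA) (@subact_shom _ _ _ iB))
  (pp_type_copair ppE).
have jI : injective (f \o iA).
  exact: inj_comp (pure_embedding_inj fP) (@incl_inj _ _ iA).
apply: Eat_gtp; exists N, (Incl jI), f, g; split=> //= [m|].
  (* Agreement on M is read off the summand M, and agreement at [a] and [b] off the generator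
     [inl 1]. *)
  by rewrite -(fg (inr m)).
by have /= := fg (inl 1); rewrite !act1.
Qed.
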